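(* Let $N$ be a Nijenhuis operator on an associative conformal algebra $\mathcal{A}$. For $a,b\in\mathcal{A}$ define $$a\succ_\lambda b=N(a)_\lambda b,\qquad a\prec_\lambda b=a_\lambda N(b),\qquad a\vee_\lambda b=-N(a_\lambda b).$$ Then $(\mathcal{A},\succ_\lambda,\prec_\lambda,\vee_\lambda)$ is a conformal NS-algebra.
   Context: All vector spaces are over $\mathbb{C}$. For $\mathbb{C}[\partial]$-modules $U,V,W$, a $\mathbb{C}$-bilinear map $U\times V\to W[\lambda]$, $(u,v)\mapsto u_\lambda v$, is conformal sesquilinear if $(\partial u)_\lambda v=-\lambda\, u_\lambda v$ and $u_\lambda(\partial v)=(\partial+\lambda)(u_\lambda v)$. Maps are extended coefficientwise to polynomials in $\lambda,\mu$. An associative conformal algebra is a $\mathbb{C}[\partial]$-module $\mathcal{A}$ with a conformal sesquilinear map $\mathcal{A}\times\mathcal{A}\to\mathcal{A}[\lambda]$, $(a,b)\mapsto a_\lambda b$, with $(a_\lambda b)_{\lambda+\mu}c=a_\lambda(b_\mu c)$ for all $a,b,c$. A Nijenhuis operator on $\mathcal{A}$ is a $\mathbb{C}[\partial]$-module homomorphism $N:\mathcal{A}\to\mathcal{A}$ with $N(a)_\lambda N(b)=N\big(N(a)_\lambda b+a_\lambda N(b)-N(a_\lambda b)\big)$ for all $a,b\in\mathcal{A}$. A conformal NS-algebra is a $\mathbb{C}[\partial]$-module $\mathcal{N}$ with three conformal sesquilinear maps $\succ_\lambda,\prec_\lambda,\vee_\lambda:\mathcal{N}\times\mathcal{N}\to\mathcal{N}[\lambda]$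 such that, with $x\times_\lambda y:=x\succ_\lambda y+x\prec_\lambda y+x\vee_\lambda y$, for all $x,y,z\in\mathcal{N}$: $x\succ_\lambda(y\succ_\mu z)=(x\times_\lambda y)\succ_{\lambda+\mu}z$; $x\prec_\lambda(y\times_\mu z)=(x\prec_\lambda y)\prec_{\lambda+\mu}z$; $x\succ_\lambda(y\prec_\mu z)=(x\succ_\lambda y)\prec_{\lambda+\mu}z$; $x\succ_\lambda(y\vee_\mu z)-(x\times_\lambda y)\vee_{\lambda+\mu}z=(x\vee_\lambda y)\prec_{\lambda+\mu}z-x\vee_\lambda(y\times_\mu z)$. *)

(* Defs.v *)
From HB Require Import structures.
From mathcomp Require Import all_boot all_order all_algebra.
From mathcomp Require Import finmap monalg.
From mathcomp Require Import complex.
From mathcomp Require Import reals.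

Set Implicit Arguments.
Unset Strict Implicit.
Unset Printing Implicit Defensive.

Import GRing.Theory.
Local Open Scope ring_scope.

(* A K[\partial]-module is an [lmodType {poly K}]: \partial acts as ['X *: _]
   and a scalar c of K as [c%:P *: _]. *)

(* W[lambda]: coefficient k is that of lambda^k. *)
Notation lpoly W := {malg W[nat]}.
(* W[lambda, mu]: coefficient (i, j) is that of lambda^i mu^j. *)
Notation lmpoly W := {malg W[(nat * nat)%type]}.

Section Coefficientwise.
Variables I J : choiceType.

Definition map_coef (V W : zmodType) (f : V -> W) (p : {malg V[I]}) :
    {malg W[I]} :=
  \sum_(k <- msupp p) << f p@_k *g k >>.

Definition map_exp (W : zmodType) (h : I -> J) (p : {malg W[I]}) :
    {malg W[J]} :=
  \sum_(k <- msupp p) << p@_k *g h k >>.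

End Coefficientwise.

Section Substitution.
Variables U V W : zmodType.

Definition mul_lambda (p : lpoly W) : lpoly W := map_exp succn p.

(* p(lambda) |-> p(lambda + mu), by the binomial formula. *)
Definition subst_add (p : lpoly W) : lmpoly W :=
  \sum_(k <- msupp p) \sum_(i < k.+1)
    << p@_k *+ 'C(k, i) *g (nat_of_ord i, (k - i)%N) >>.

(* u_lambda q for q = \sum_j q_j mu^j in V[mu]:
   \sum_j (u_lambda q_j) mu^j. *)
Definition ext_right (op : U -> V -> lpoly W) (u : U) (q : lpoly V) :
    lmpoly W :=
  \sum_(j <- msupp q) map_exp (fun i => (i, j)) (op u q@_j).

(* p_(lambda + mu) v for p = \sum_i p_i lambda^i in U[lambda]:
   \sum_i lambda^i ((p_i)_(lambda + mu) v). *)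
Definition ext_left (op : U -> V -> lpoly W) (p : lpoly U) (v : V) :
    lmpoly W :=
  \sum_(i <- msupp p)
    map_exp (fun k => ((i + k.1)%N, k.2)) (subst_add (op p@_i v)).

End Substitution.

Section Conformal.
Variable K : fieldType.

Record conformal_sesquilinear (U V W : lmodType {poly K})
    (op : U -> V -> lpoly W) : Prop := {
  conformal_linearl : forall (c : K) (u1 u2 : U) (v : V),
    op (c%:P *: u1 + u2) v = map_coef ( *:%R c%:P) (op u1 v) + op u2 v;
  conformal_linearr : forall (c : K) (u : U) (v1 v2 : V),
    op u (c%:P *: v1 + v2) = map_coef ( *:%R c%:P) (op u v1) + op u v2;
  conformal_derivl : forall (u : U) (v : V),
    op ('X *: u) v = - mul_lambda (op u v);
  conformal_derivr : forall (u : U) (v : V),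
    op u ('X *: v) = map_coef ( *:%R 'X) (op u v) + mul_lambda (op u v) }.

Record assoc_conformal_algebra (A : lmodType {poly K})
    (op : A -> A -> lpoly A) : Prop := {
  assoc_conformal_sesquilinear : conformal_sesquilinear op;
  assoc_conformalA : forall a b c : A,
    ext_left op (op a b) c = ext_right op a (op b c) }.

Definition nijenhuis_operator (A : lmodType {poly K})
    (op : A -> A -> lpoly A) (N : {linear A -> A}) : Prop :=
  forall a b : A,
    op (N a) (N b) =
      map_coef N (op (N a) b + op a (N b) - map_coef N (op a b)).

Definition ns_total (A : lmodType {poly K}) (succ prec vee : A -> A -> lpoly A)
    (x y : A) : lpoly A :=
  succ x y + prec x y + vee x y.

Record conformal_NS_algebra (A : lmodType {poly K})
    (succ prec vee : A -> A -> lpoly A) : Prop := {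
  ns_succ_sesquilinear : conformal_sesquilinear succ;
  ns_prec_sesquilinear : conformal_sesquilinear prec;
  ns_vee_sesquilinear : conformal_sesquilinear vee;
  ns_succ_succ : forall x y z : A,
    ext_right succ x (succ y z) =
      ext_left succ (ns_total succ prec vee x y) z;
  ns_prec_total : forall x y z : A,
    ext_right prec x (ns_total succ prec vee y z) =
      ext_left prec (prec x y) z;
  ns_succ_prec : forall x y z : A,
    ext_right succ x (prec y z) = ext_left prec (succ x y) z;
  ns_succ_vee : forall x y z : A,
    ext_right succ x (vee y z) -
        ext_left vee (ns_total succ prec vee x y) z =
      ext_left prec (vee x y) z -
        ext_right vee x (ns_total succ prec vee y z) }.

Section FromNijenhuis.
Variables (A : lmodType {poly K}) (op : A -> A -> lpoly A) (N : {linear A -> A}).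

Definition nij_succ (a b : A) : lpoly A := op (N a) b.
Definition nij_prec (a b : A) : lpoly A := op a (N b).
Definition nij_vee (a b : A) : lpoly A := - map_coef N (op a b).

End FromNijenhuis.

End Conformal.

(* Main.v *)
From HB Require Import structures.
Require Import Defs.
From mathcomp Require Import all_boot all_order all_algebra.
From mathcomp Require Import finmap monalg complex reals.

Set Implicit Arguments.
Unset Strict Implicit.
Unset Printing Implicit Defensive.

Import GRing.Theory.
Local Open Scope ring_scope.

(* Extend N coefficientwise to A[lambda, mu].  It commutes with the coefficientwise
   extensions of the lambda-product, so the Nijenhuis identity persists when one
   of the two arguments is a polynomial.  The first three NS axioms are then
   associativity with N applied to some of the arguments; in the fourth,
   expanding N(x)_lambda N(y_mu z) and N(x_lambda y)_(lambda+mu) N(z) by this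
   identity leaves the same terms on both sides. *)

(** * Sums over the support of terms additive in the coefficient *)

Section SuppSum.
Variables (I : choiceType) (V M : zmodType) (G : I -> {additive V -> M}).

(** Outside the support the coefficient is 0 and [G k] sends it to 0. Polynomials with different
    supports can thus be summed over a common index set. *)
Lemma msupp_sumEw (d : {fset I}) (p : {malg V[I]}) : (msupp p `<=` d)%fset ->
  \sum_(k <- msupp p) G k p@_k = \sum_(k <- d) G k p@_k.
Proof.
by move=> le_pd; apply: big_fset_incl => // k _ /mcoeff_outdom ->; rewrite raddf0.
Qed.

(** The source of additivity for [map_coef], [map_exp], [subst_add], [ext_left] and [ext_right]:
    each is a sum of this shape for its own [G]. *)
Lemma msupp_sumB (p q : {malg V[I]}) :
  \sum_(k <- msupp (p - q)) G k (p - q)@_k =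
    \sum_(k <- msupp p) G k p@_k - \sum_(k <- msupp q) G k q@_k.
Proof.
rewrite (msupp_sumEw (msuppB_le p q)).
rewrite (msupp_sumEw (fsubsetUl (msupp p) (msupp q))).
rewrite (msupp_sumEw (fsubsetUr (msupp p) (msupp q))) -sumrB.
by apply: eq_bigr => k _; rewrite mcoeffB raddfB.
Qed.

Lemma msupp_sumU (a : V) (k : I) :
  \sum_(i <- msupp << a *g k >>) G i << a *g k >>@_i = G k a.
Proof.
by rewrite (msupp_sumEw msuppU_le) big_seq_fset1 mcoeffUU.
Qed.

Lemma msupp_sum_sum (J : Type) (r : seq J) (P : pred J) (F : J -> {malg V[I]}) :
  \sum_(k <- msupp (\sum_(j <- r | P j) F j)) G k (\sum_(j <- r | P j) F j)@_k =
    \sum_(j <- r | P j) \sum_(k <- msupp (F j)) G k (F j)@_k.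
Proof.
pose S (p : {malg V[I]}) := \sum_(k <- msupp p) G k p@_k.
have sum0 : S 0 = 0 by rewrite /S msupp0 big_seq_fset0.
apply: (big_morph S _ sum0) => p q.
(* Additivity is read off from subtractivity at [(p + q) - q]. *)
have /eqP := msupp_sumB (p + q) q; rewrite addrK eq_sym subr_eq => /eqP; exact.
Qed.

End SuppSum.

(** * Coefficientwise maps, changes of exponent, and the substitution of $\lambda+\mu$ *)

Section CoefficientwiseAdditive.
Variables I J : choiceType.

Lemma map_coef_is_zmod_morphism (V W : zmodType) (f : {additive V -> W}) :
  zmod_morphism (@map_coef I V W f).
Proof.
by move=> p q; exact: (msupp_sumB (fun k => mkmalgU k \o f)).
Qed.

HB.instance Definition _ (V W : zmodType) (f : {additive V -> W}) :=
  GRing.isZmodMorphism.Build {malg V[I]} {malg W[I]} (map_coef f)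
    (map_coef_is_zmod_morphism f).

Lemma map_exp_is_zmod_morphism (W : zmodType) (h : I -> J) :
  zmod_morphism (@map_exp I J W h).
Proof. by move=> p q; exact: (msupp_sumB (fun k => mkmalgU (h k))). Qed.

HB.instance Definition _ (W : zmodType) (h : I -> J) :=
  GRing.isZmodMorphism.Build {malg W[I]} {malg W[J]} (map_exp h)
    (map_exp_is_zmod_morphism h).

Lemma map_coefU (V W : zmodType) (f : {additive V -> W}) (a : V) (k : I) :
  map_coef f << a *g k >> = << f a *g k >>.
Proof. exact: (msupp_sumU (fun k => mkmalgU k \o f)). Qed.

Lemma map_expU (W : zmodType) (h : I -> J) (a : W) (k : I) :
  map_exp h << a *g k >> = << a *g h k >>.
Proof. exact: (msupp_sumU (fun k => mkmalgU (h k))). Qed.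

End CoefficientwiseAdditive.

Section CoefficientwiseTheory.
Variables I J : choiceType.

Lemma map_coef_exp (V W : zmodType) (f : {additive V -> W}) (h : I -> J)
    (p : {malg V[I]}) :
  map_coef f (map_exp h p) = map_exp h (map_coef f p).
Proof.
rewrite [map_coef f p]/map_coef {1}/map_exp [LHS]raddf_sum [RHS]raddf_sum.
by apply: eq_bigr => k _; rewrite /= map_coefU map_expU.
Qed.

Lemma eq_map_coef (V W : zmodType) (f g : V -> W) (p : {malg V[I]}) :
  f =1 g -> map_coef f p = map_coef g p.
Proof. by move=> fg; apply: eq_bigr => k _; rewrite fg. Qed.

Lemma map_coef_comp (U V W : zmodType) (f : {additive V -> W})
    (g : {additive U -> V}) (p : {malg U[I]}) :
  map_coef f (map_coef g p) = map_coef (f \o g) p.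
Proof.
by rewrite [map_coef g p]/map_coef raddf_sum; apply: eq_bigr => k _; rewrite /= map_coefU.
Qed.

End CoefficientwiseTheory.

(** The expansion of $a(\lambda+\mu)^k$, isolated because its additivity in [a] makes [subst_add] a
    support sum. *)
Definition subst_add_mono (W : zmodType) (k : nat) (a : W) : lmpoly W :=
  \sum_(i < k.+1) << a *+ 'C(k, i) *g (nat_of_ord i, (k - i)%N) >>.

Lemma subst_add_mono_is_zmod_morphism (W : zmodType) k :
  zmod_morphism (@subst_add_mono W k).
Proof.
by move=> a b; rewrite -sumrB; apply: eq_bigr => i _; rewrite mulrnBl raddfB.
Qed.

HB.instance Definition _ (W : zmodType) k :=
  GRing.isZmodMorphism.Build W (lmpoly W) (@subst_add_mono W k)
    (@subst_add_mono_is_zmod_morphism W k).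

Lemma subst_add_is_zmod_morphism (W : zmodType) : zmod_morphism (@subst_add W).
Proof. exact: (msupp_sumB (@subst_add_mono W)). Qed.

HB.instance Definition _ (W : zmodType) :=
  GRing.isZmodMorphism.Build (lpoly W) (lmpoly W) (@subst_add W)
    (@subst_add_is_zmod_morphism W).

Lemma map_coef_subst_add (V W : zmodType) (f : {additive V -> W}) (p : lpoly V) :
  map_coef f (subst_add p) = subst_add (map_coef f p).
Proof.
rewrite [map_coef f p]/map_coef {1}/subst_add [LHS]raddf_sum [RHS]raddf_sum.
apply: eq_bigr => k _; rewrite [RHS](msupp_sumU (@subst_add_mono W)) raddf_sum.
by apply: eq_bigr => i _; rewrite /= map_coefU raddfMn.
Qed.

(** * Dependence of the two extensions on the product *)

Section Extensions.
Variables U V W : zmodType.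
Implicit Types (op : U -> V -> lpoly W) (p : lpoly U) (q : lpoly V).

Lemma eq_ext_left op1 op2 p v : (forall u, op1 u v = op2 u v) ->
  ext_left op1 p v = ext_left op2 p v.
Proof. by move=> e; apply: eq_bigr => i _; rewrite e. Qed.

Lemma eq_ext_right op1 op2 u q : (forall v, op1 u v = op2 u v) ->
  ext_right op1 u q = ext_right op2 u q.
Proof. by move=> e; apply: eq_bigr => i _; rewrite e. Qed.

(** The sum is taken in the product, not in an argument. This and its companions gather the terms of
    an identity into a single extension, where it can be checked coefficient by coefficient. *)
Lemma ext_leftD op1 op2 p v :
  ext_left (fun a b => op1 a b + op2 a b) p v =
    ext_left op1 p v + ext_left op2 p v.
Proof. by rewrite -big_split; apply: eq_bigr => i _; rewrite !raddfD. Qed.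

Lemma ext_leftN op p v :
  ext_left (fun a b => - op a b) p v = - ext_left op p v.
Proof. by rewrite -sumrN; apply: eq_bigr => i _; rewrite !raddfN. Qed.

Lemma ext_rightD op1 op2 u q :
  ext_right (fun a b => op1 a b + op2 a b) u q =
    ext_right op1 u q + ext_right op2 u q.
Proof. by rewrite -big_split; apply: eq_bigr => i _; rewrite !raddfD. Qed.

Lemma ext_rightN op u q :
  ext_right (fun a b => - op a b) u q = - ext_right op u q.
Proof. by rewrite -sumrN; apply: eq_bigr => i _; rewrite !raddfN. Qed.

Lemma map_coef_ext_left (W' : zmodType) (f : {additive W -> W'}) op p v :
  map_coef f (ext_left op p v) = ext_left (fun a b => map_coef f (op a b)) p v.
Proof.
by rewrite raddf_sum; apply: eq_bigr => i _; rewrite /= map_coef_exp map_coef_subst_add.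
Qed.

Lemma map_coef_ext_right (W' : zmodType) (f : {additive W -> W'}) op u q :
  map_coef f (ext_right op u q) = ext_right (fun a b => map_coef f (op a b)) u q.
Proof. by rewrite raddf_sum; apply: eq_bigr => i _; rewrite /= map_coef_exp. Qed.

End Extensions.

(** * Additivity of the extensions in their polynomial argument *)

Section Biadditive.
Variables (U V W : zmodType) (op : U -> V -> lpoly W).
Hypothesis opBl : forall v, zmod_morphism (op^~ v).
Hypothesis opBr : forall u, zmod_morphism (op u).

Let opl v : {additive U -> lpoly W} :=
  HB.pack (op^~ v) (GRing.isZmodMorphism.Build U (lpoly W) (op^~ v) (opBl v)).
Let opr u : {additive V -> lpoly W} :=
  HB.pack (op u) (GRing.isZmodMorphism.Build V (lpoly W) (op u) (opBr u)).

(** The map $u\mapsto\lambda^i(u_{\lambda+\mu}v)$, which serves as [G] for [ext_left]. *)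
Let left_coef v i : {additive U -> lmpoly W} :=
  map_exp (fun k : nat * nat => ((i + k.1)%N, k.2)) \o (@subst_add W \o opl v).
Let right_coef u j : {additive V -> lmpoly W} :=
  map_exp (fun i : nat => (i, j)) \o opr u.

Lemma ext_leftBl v : zmod_morphism ((ext_left op)^~ v).
Proof. exact: (msupp_sumB (left_coef v)). Qed.

Lemma ext_rightBr u : zmod_morphism (ext_right op u).
Proof. exact: (msupp_sumB (right_coef u)). Qed.

Let ext_left_additive v : {additive lpoly U -> lmpoly W} :=
  HB.pack ((ext_left op)^~ v)
    (GRing.isZmodMorphism.Build _ _ ((ext_left op)^~ v) (ext_leftBl v)).
Let ext_right_additive u : {additive lpoly V -> lmpoly W} :=
  HB.pack (ext_right op u)
    (GRing.isZmodMorphism.Build _ _ (ext_right op u) (ext_rightBr u)).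

Lemma ext_leftNl p v : ext_left op (- p) v = - ext_left op p v.
Proof. exact: (raddfN (ext_left_additive v)). Qed.

Lemma ext_leftDl p q v : ext_left op (p + q) v = ext_left op p v + ext_left op q v.
Proof. exact: (raddfD (ext_left_additive v)). Qed.

Lemma ext_rightNr u q : ext_right op u (- q) = - ext_right op u q.
Proof. exact: (raddfN (ext_right_additive u)). Qed.

Lemma ext_rightDr u p q :
  ext_right op u (p + q) = ext_right op u p + ext_right op u q.
Proof. exact: (raddfD (ext_right_additive u)). Qed.

(** Since [f] may kill coefficients, [map_coef f p] can have a smaller support than [p]; additivity
    of [op] in its first argument makes the lost terms zero. *)
Lemma ext_left_map_coef (U' : zmodType) (f : {additive U' -> U}) p v :
  ext_left op (map_coef f p) v = ext_left (fun a b => op (f a) b) p v.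
Proof.
rewrite /map_coef [LHS](msupp_sum_sum (left_coef v)).
by apply: eq_bigr => k _; rewrite (msupp_sumU (left_coef v)).
Qed.

Lemma ext_right_map_coef (V' : zmodType) (f : {additive V' -> V}) u q :
  ext_right op u (map_coef f q) = ext_right (fun a b => op a (f b)) u q.
Proof.
rewrite /map_coef [LHS](msupp_sum_sum (right_coef u)).
by apply: eq_bigr => k _; rewrite (msupp_sumU (right_coef u)).
Qed.

End Biadditive.

(** * Consequences and stability of conformal sesquilinearity *)

Section SesquilinearTheory.
Variables (K : fieldType) (U V W : lmodType {poly K}) (op : U -> V -> lpoly W).
Hypothesis op_sesqui : conformal_sesquilinear op.

Lemma map_coef_scaleN1 (p : lpoly W) : map_coef ( *:%R (-1)%:P) p = - p.
Proof.
rewrite [in RHS](monalgE p) -sumrN.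
by apply: eq_bigr => k _; rewrite polyCN scaleN1r monalgUN.
Qed.

(** This is the linearity axiom with scalar $-1$, after writing [u1 - u2] as
    [(-1)%:P *: u2 + u1]. *)
Lemma conformal_sesquilinearBl v : zmod_morphism (op^~ v).
Proof.
move=> u1 u2; rewrite /= addrC -scaleN1r -polyC1 -polyCN.
by rewrite (conformal_linearl op_sesqui) map_coef_scaleN1 addrC.
Qed.

Lemma conformal_sesquilinearBr u : zmod_morphism (op u).
Proof.
move=> v1 v2; rewrite addrC -scaleN1r -polyC1 -polyCN.
by rewrite (conformal_linearr op_sesqui) map_coef_scaleN1 addrC.
Qed.

Lemma conformal_sesquilinear_compl (U' : lmodType {poly K})
    (f : {linear U' -> U}) : conformal_sesquilinear (fun u v => op (f u) v).
Proof.
case: op_sesqui => Ll Lr Dl Dr; split=> *; rewrite ?linearP ?linearZ /=.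
- exact: Ll.
- exact: Lr.
- exact: Dl.
- exact: Dr.
Qed.

Lemma conformal_sesquilinear_compr (V' : lmodType {poly K})
    (f : {linear V' -> V}) : conformal_sesquilinear (fun u v => op u (f v)).
Proof.
case: op_sesqui => Ll Lr Dl Dr; split=> *; rewrite ?linearP ?linearZ /=.
- exact: Ll.
- exact: Lr.
- exact: Dl.
- exact: Dr.
Qed.

Lemma map_coef_scale (W' : lmodType {poly K}) (f : {linear W -> W'})
    (c : {poly K}) (p : lpoly W) :
  map_coef f (map_coef ( *:%R c) p) = map_coef ( *:%R c) (map_coef f p).
Proof.
by rewrite !map_coef_comp; apply: eq_map_coef => a /=; rewrite linearZ.
Qed.

(** Linearity of [f] over [{poly K}] covers both constants and ['X], and acting on coefficients
    alone commutes with multiplication by $\lambda$. *)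
Lemma conformal_sesquilinear_map_coef (W' : lmodType {poly K})
    (f : {linear W -> W'}) :
  conformal_sesquilinear (fun u v => map_coef f (op u v)).
Proof.
case: op_sesqui => Ll Lr Dl Dr; split=> *.
- by rewrite Ll raddfD /= map_coef_scale.
- by rewrite Lr raddfD /= map_coef_scale.
- by rewrite Dl raddfN /= map_coef_exp.
- by rewrite Dr raddfD /= map_coef_scale map_coef_exp.
Qed.

Lemma conformal_sesquilinearN : conformal_sesquilinear (fun u v => - op u v).
Proof.
case: op_sesqui => Ll Lr Dl Dr; split=> *.
- by rewrite Ll opprD [map_coef _ (- _)]raddfN.
- by rewrite Lr opprD [map_coef _ (- _)]raddfN.
- by rewrite Dl /mul_lambda [map_exp _ (- _)]raddfN.
- by rewrite Dr /mul_lambda opprD [map_coef _ (- _)]raddfN [map_exp _ (- _)]raddfN.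
Qed.

End SesquilinearTheory.

(** * The Nijenhuis identity with a polynomial argument, and the NS axioms *)

Section Nijenhuis.
Variables (K : fieldType) (A : lmodType {poly K}) (op : A -> A -> lpoly A).
Variable N : {linear A -> A}.
Hypothesis op_assoc : assoc_conformal_algebra op.
Hypothesis nijN : nijenhuis_operator op N.

Let opBl := conformal_sesquilinearBl (assoc_conformal_sesquilinear op_assoc).
Let opBr := conformal_sesquilinearBr (assoc_conformal_sesquilinear op_assoc).

(** Once every term is written as the extension of some product to [p] and [z], the claim is [nijN]
    at each coefficient of [p]. *)
Lemma nijenhuis_ext_left p z :
  ext_left op (map_coef N p) (N z) =
    map_coef N (ext_left op (map_coef N p) z + ext_left op p (N z) -
                map_coef N (ext_left op p z)).
Proof.
rewrite !(ext_left_map_coef opBl) map_coef_ext_left -ext_leftN.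
(* The second argument enters [ext_left] unchanged, so [N] moves from [z] into the product by
   conversion. *)
rewrite -[ext_left op p (N z)]/(ext_left (fun a b => op a (N b)) p z).
rewrite -!ext_leftD map_coef_ext_left.
rewrite -[LHS]/(ext_left (fun a b => op (N a) (N b)) p z).
by apply: eq_ext_left => a; exact: nijN.
Qed.

Lemma nijenhuis_ext_right x q :
  ext_right op (N x) (map_coef N q) =
    map_coef N (ext_right op (N x) q + ext_right op x (map_coef N q) -
                map_coef N (ext_right op x q)).
Proof.
rewrite !(ext_right_map_coef opBr) map_coef_ext_right -ext_rightN.
rewrite -[ext_right op (N x) q]/(ext_right (fun a b => op (N a) b) x q).
rewrite -!ext_rightD map_coef_ext_right.
rewrite -[LHS]/(ext_right (fun a b => op (N a) (N b)) x q).
by apply: eq_ext_right => b; exact: nijN.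
Qed.

(** With the sign in [nij_vee], the total product is the argument of the outer [N] in the Nijenhuis
    identity, so [N] carries $\times_\lambda$ to the original product. *)
Lemma map_coef_nij_total x y :
  map_coef N (ns_total (nij_succ op N) (nij_prec op N) (nij_vee op N) x y) =
    op (N x) (N y).
Proof. by rewrite nijN. Qed.

Lemma ext_left_nij_succ p z :
  ext_left (nij_succ op N) p z = ext_left op (map_coef N p) z.
Proof. by rewrite (ext_left_map_coef opBl). Qed.

Lemma ext_left_nij_vee p z :
  ext_left (nij_vee op N) p z = - map_coef N (ext_left op p z).
Proof. by rewrite map_coef_ext_left -ext_leftN. Qed.

Lemma ext_right_nij_prec x q :
  ext_right (nij_prec op N) x q = ext_right op x (map_coef N q).
Proof. by rewrite (ext_right_map_coef opBr). Qed.

Lemma ext_right_nij_vee x q :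
  ext_right (nij_vee op N) x q = - map_coef N (ext_right op x q).
Proof. by rewrite map_coef_ext_right -ext_rightN. Qed.

Lemma nijenhuis_conformal_NS_algebra :
  conformal_NS_algebra (nij_succ op N) (nij_prec op N) (nij_vee op N).
Proof.
have sesq := assoc_conformal_sesquilinear op_assoc.
have opA := assoc_conformalA op_assoc.
split.
- exact: conformal_sesquilinear_compl.
- exact: conformal_sesquilinear_compr.
- exact/conformal_sesquilinearN/conformal_sesquilinear_map_coef.
(* The first three identities are associativity for the triples $(N(x),N(y),z)$, $(x,N(y),N(z))$ and
   $(N(x),y,N(z))$. *)
- by move=> x y z; rewrite ext_left_nij_succ map_coef_nij_total opA.
- by move=> x y z; rewrite ext_right_nij_prec map_coef_nij_total -opA.
- by move=> x y z; exact/esym/opA.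
- move=> x y z.
  have succ_E q : ext_right (nij_succ op N) x q = ext_right op (N x) q by [].
  have prec_E p : ext_left (nij_prec op N) p z = ext_left op p (N z) by [].
  rewrite succ_E prec_E ext_left_nij_vee ext_right_nij_vee !opprK /ns_total.
  rewrite !(ext_leftDl opBl) !(ext_rightDr opBr) /nij_vee.
  rewrite !(ext_leftNl opBl) !(ext_rightNr opBr).
  rewrite nijenhuis_ext_left nijenhuis_ext_right /nij_succ /nij_prec.
  rewrite !opA.
  (* In short notation, $P=N(x)(yz)$, $Q=x\,N(yz)$, $S=x(N(y)z)$, $T=x(y\,N(z))$, and below
     $NN=N(x(yz))$, $L=N(xy)z$. *)
  move: (ext_right op (N x) _) (ext_right op x (map_coef N _)) => P Q.
  move: (ext_right op x (op (N y) z)) (ext_right op x (op y (N z))) => S T.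
  move: (map_coef N (ext_right op x _)) (ext_left _ _ _) => NN L.
  have subDD (M : zmodType) (a b c : M) : (a + b) - (a + c) = b - c.
    by rewrite opprD addrACA subrr add0r.
  (* Both sides are differences of values of [N]. Inside it, $P$ cancels on the left and $T$ on the
     right, leaving $S-L-Q+NN$ on each side. *)
  rewrite addrC [RHS]addrC -!(raddfB (map_coef N)); congr (map_coef _ _).
  rewrite -[P + S - L]addrA -[P + Q - NN]addrA subDD [S + T]addrC [L + T]addrC.
  rewrite -[T + S - Q]addrA -[T + L - NN]addrA subDD.
  by rewrite !opprB addrACA [RHS]addrACA [- L - Q]addrC.
Qed.

End Nijenhuis.

Theorem theorem5p5 (R : realType) (A : lmodType {poly R[i]})
    (op : A -> A -> lpoly A) (N : {linear A -> A}) :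
  assoc_conformal_algebra op ->
  nijenhuis_operator op N ->
  conformal_NS_algebra (nij_succ op N) (nij_prec op N) (nij_vee op N).
Proof. exact: nijenhuis_conformal_NS_algebra. Qed.
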